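(* Let $\mathbb H$ be the division ring of quaternions over the real field, with basis $1,i,j,k$, and for $x=x^0+x^1i+x^2j+x^3k\in\mathbb H$ ($x^0,\dots,x^3\in\mathbb R$) let $\overline x=x^0-x^1i-x^2j-x^3k$ be the conjugate quaternion. Then for every $x\in\mathbb H$ $$\overline x=-\frac12\,(x+ixi+jxj+kxk).$$
   Context: Multiplication in $\mathbb H$: $i^2=j^2=k^2=-1$, $ij=k=-ji$, $jk=i=-kj$, $ki=j=-ik$. *)

(* Defs.v *)
From HB Require Import structures.
From mathcomp Require Import all_boot all_order all_algebra.
From mathcomp Require Import reals ring lra.

Set Implicit Arguments.
Unset Strict Implicit.
Unset Printing Implicit Defensive.

Import Order.TTheory GRing.Theory Num.Theory.
Local Open Scope ring_scope.

Record quaternion (R : Type) : Type :=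
  Quaternion { q0 : R; q1 : R; q2 : R; q3 : R }.

Section Structures.

Definition tuple_of_quat (R : Type) (x : quaternion R) : R * R * R * R :=
  (q0 x, q1 x, q2 x, q3 x).
Definition quat_of_tuple (R : Type) (t : R * R * R * R) : quaternion R :=
  let: (a, b, c, d) := t in Quaternion a b c d.

Lemma tuple_of_quatK (R : Type) :
  cancel (@tuple_of_quat R) (@quat_of_tuple R).
Proof. by case. Qed.

HB.instance Definition _ (R : eqType) :=
  Equality.copy (quaternion R) (can_type (@tuple_of_quatK R)).
HB.instance Definition _ (R : choiceType) :=
  Choice.copy (quaternion R) (can_type (@tuple_of_quatK R)).

Lemma quatP (R : Type) (x y : quaternion R) :
  q0 x = q0 y -> q1 x = q1 y -> q2 x = q2 y -> q3 x = q3 y -> x = y.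
Proof. by case: x y => [a b c d] [? ? ? ?] /= -> -> -> ->. Qed.

Variable R : realFieldType.
Implicit Types (a : R) (x y z : quaternion R).

Definition addq x y :=
  Quaternion (q0 x + q0 y) (q1 x + q1 y) (q2 x + q2 y) (q3 x + q3 y).
Definition oppq x := Quaternion (- q0 x) (- q1 x) (- q2 x) (- q3 x).
Definition zeroq : quaternion R := Quaternion 0 0 0 0.

Lemma addqA : associative addq.
Proof. by move=> x y z; apply: quatP; exact: addrA. Qed.
Lemma addqC : commutative addq.
Proof. by move=> x y; apply: quatP; exact: addrC. Qed.
Lemma add0q : left_id zeroq addq.
Proof. by move=> x; apply: quatP; exact: add0r. Qed.
Lemma addNq : left_inverse zeroq oppq addq.
Proof. by move=> x; apply: quatP; exact: addNr. Qed.

HB.instance Definition _ :=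
  GRing.isZmodule.Build (quaternion R) addqA addqC add0q addNq.

(* The bilinear extension of the multiplication table of the basis 1, i, j, k
   (see [quat_table] below). *)
Definition mulq x y :=
  Quaternion
    (q0 x * q0 y - q1 x * q1 y - q2 x * q2 y - q3 x * q3 y)
    (q0 x * q1 y + q1 x * q0 y + q2 x * q3 y - q3 x * q2 y)
    (q0 x * q2 y - q1 x * q3 y + q2 x * q0 y + q3 x * q1 y)
    (q0 x * q3 y + q1 x * q2 y - q2 x * q1 y + q3 x * q0 y).
Definition oneq : quaternion R := Quaternion 1 0 0 0.

Lemma mulqA : associative mulq.
Proof. by move=> x y z; apply: quatP => /=; ring. Qed.
Lemma mul1q : left_id oneq mulq.
Proof. by move=> x; apply: quatP => /=; ring. Qed.
Lemma mulq1 : right_id oneq mulq.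
Proof. by move=> x; apply: quatP => /=; ring. Qed.
Lemma mulqDl : left_distributive mulq +%R.
Proof. by move=> x y z; apply: quatP => /=; ring. Qed.
Lemma mulqDr : right_distributive mulq +%R.
Proof. by move=> x y z; apply: quatP => /=; ring. Qed.
Lemma oneq_neq0 : oneq != 0.
Proof. by apply/eqP => -[] /eqP; rewrite oner_eq0. Qed.

HB.instance Definition _ :=
  GRing.Zmodule_isNzRing.Build (quaternion R)
    mulqA mul1q mulq1 mulqDl mulqDr oneq_neq0.

Definition scaleq a x := Quaternion (a * q0 x) (a * q1 x) (a * q2 x) (a * q3 x).

Lemma scaleqA a b x : scaleq a (scaleq b x) = scaleq (a * b) x.
Proof. by apply: quatP; exact: mulrA. Qed.
Lemma scale1q : left_id 1 scaleq.
Proof. by move=> x; apply: quatP; exact: mul1r. Qed.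
Lemma scaleqDr : right_distributive scaleq +%R.
Proof. by move=> a x y; apply: quatP; exact: mulrDr. Qed.
Lemma scaleqDl x : {morph scaleq^~ x : a b / a + b}.
Proof. by move=> a b; apply: quatP; exact: mulrDl. Qed.

HB.instance Definition _ :=
  GRing.Zmodule_isLmodule.Build R (quaternion R)
    scaleqA scale1q scaleqDr scaleqDl.

Lemma scaleqAl a x y : a *: (x * y) = (a *: x) * y.
Proof. by apply: quatP => /=; ring. Qed.
HB.instance Definition _ :=
  GRing.Lmodule_isLalgebra.Build R (quaternion R) scaleqAl.

Lemma scaleqAr a x y : a *: (x * y) = x * (a *: y).
Proof. by apply: quatP => /=; ring. Qed.
HB.instance Definition _ :=
  GRing.Lalgebra_isAlgebra.Build R (quaternion R) scaleqAr.

Definition sqnormq x := q0 x ^+ 2 + q1 x ^+ 2 + q2 x ^+ 2 + q3 x ^+ 2.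

Lemma sqnormq_eq0 x : (sqnormq x == 0) = (x == 0).
Proof.
apply/idP/eqP => [|->]; last by rewrite /sqnormq /= expr0n /= !addr0.
rewrite /sqnormq !paddr_eq0 ?addr_ge0 ?sqr_ge0 // !sqrf_eq0.
by move=> /andP[/andP[/andP[/eqP ? /eqP ?] /eqP ?] /eqP ?]; apply: quatP.
Qed.

Definition invq x :=
  (sqnormq x)^-1 *: Quaternion (q0 x) (- q1 x) (- q2 x) (- q3 x).

Lemma mulVq : {in [pred x | x != 0], left_inverse 1 invq *%R}.
Proof.
move=> x; rewrite inE -sqnormq_eq0 /sqnormq => x0.
by apply: quatP; rewrite /= /sqnormq; field.
Qed.
Lemma mulqV : {in [pred x | x != 0], right_inverse 1 invq *%R}.
Proof.
move=> x; rewrite inE -sqnormq_eq0 /sqnormq => x0.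
by apply: quatP; rewrite /= /sqnormq; field.
Qed.
Lemma unitqP x y : y * x = 1 /\ x * y = 1 -> x != 0.
Proof.
move=> [+ _]; apply: contra_eq_neq => ->.
by rewrite mulr0 eq_sym oner_neq0.
Qed.
Lemma invq_out : {in [predC [pred x | x != 0]], invq =1 id}.
Proof.
move=> x; rewrite !inE negbK => /eqP ->.
by apply: quatP; rewrite /= ?oppr0 mulr0.
Qed.

HB.instance Definition _ :=
  GRing.NzRing_hasMulInverse.Build (quaternion R)
    mulVq mulqV unitqP invq_out.

Lemma quat_division_ring x : (x \is a GRing.unit) = (x != 0).
Proof. by []. Qed.

Definition qi : quaternion R := Quaternion 0 1 0 0.
Definition qj : quaternion R := Quaternion 0 0 1 0.
Definition qk : quaternion R := Quaternion 0 0 0 1.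

Lemma quat_table :
  [/\ [/\ qi * qi = -1, qj * qj = -1 & qk * qk = -1],
      (qi * qj = qk) * (qj * qi = - qk),
      (qj * qk = qi) * (qk * qj = - qi)
    & (qk * qi = qj) * (qi * qk = - qj)].
Proof. by split; split; apply: quatP => /=; ring. Qed.

Lemma quat_basis a b c d :
  a%:A + b *: qi + c *: qj + d *: qk = Quaternion a b c d.
Proof. by apply: quatP => /=; ring. Qed.

Definition conjq x : quaternion R :=
  (q0 x)%:A - q1 x *: qi - q2 x *: qj - q3 x *: qk.

End Structures.

Arguments qi {R}.
Arguments qj {R}.
Arguments qk {R}.

(* Main.v *)
Require Import Defs.
From mathcomp Require Import all_boot all_order all_algebra reals.
From mathcomp Require Import ring.
Import GRing.Theory.
Local Open Scope ring_scope.

(** For a unit [e] among [qi], [qj], [qk], the map [x |-> e * x * e] negates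
    the components of [x] along [1] and [e], which commute with [e], and fixes
    the other two, which anticommute with it. In the sum of the identity and
    these three maps, the real part thus gets the coefficient 1 - 3 = -2 and
    each imaginary part 1 - 1 + 1 + 1 = 2; scaling by -1/2 gives the conjugate.
    Comparing coordinates turns this into four linear identities. *)
Theorem theorem14p3 (R : realType) (x : quaternion R) :
  conjq x = (- (1 / 2)) *: (x + qi * x * qi + qj * x * qj + qk * x * qk).
Proof. by apply: quatP => /=; field. Qed.
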